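(* For any two filtered chain complexes $(C_*,\partial_C,\ell_C)$ and $(D_*,\partial_D,\ell_D)$ over $\mathbb{F}$, $$\sup_{k\in \mathbb{Z}_{\geq 0}} d_{\mathrm M}\left(\mathcal{B}_{\mathrm{Ver},k}(C_* ),\mathcal{B}_{\mathrm{Ver},k}(D_* )\right)= d_{\mathrm I}\left((C_*,\partial_C,\ell_C),(D_*,\partial_D,\ell_D)\right).$$
   Context: Fix a field $\mathbb{F}$. All chain complexes are over $\mathbb{F}$, concentrated in degrees $k\ge 0$, and have finite total dimension $\sum_{k\ge 0}\dim C_k<\infty$. Filtration functions. A filtration function on a finite-dimensional vector space $V$ is a map $\ell:V\to\mathbb{R}\sqcup\{-\infty\}$ with (i) $\ell(x)=-\infty$ iff $x=0$; (ii) $\ell(\lambda x)=\ell(x)$ for $0\ne\lambda\in\mathbb{F}$; (iii) $\ell(x+y)\le\max\{\ell(x),\ell(y)\}$. Elements $x_1,\dots,x_r$ are orthogonal if $\ell(\sum\lambda_ix_i)=\max_{\lambda_i\neq0}\ell(x_i)$ for all scalars $\lambda_i$. $(V,\ell)$ is orthogonalizable if it has an orthogonal basis. Filtered chain complex (FCC). A chain complex $(C_*=\bigoplus_{k} C_k,\partial_C)$ with a function $\ell_C:C_*\to\mathbb{R}\sqcup\{-\infty\}$ such that each $(C_k,\ell_C|_{C_k})$ is orthogonalizable and $\ell_C\circ\partial_C\le\ell_C$ (on a sum $\sum_k c_k$ with $c_k\in C_k$, $\ell_C$ is $\max_k\ell_C(c_k)$). Verbose barcode. A singular value decomposition of a linear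 map $A:C\to D$ of rank $r$ between orthogonalizable spaces is a pair of orthogonal ordered bases $(y_1,\dots,y_n)$ of $C$ and $(x_1,\dots,x_m)$ of $D$ such that $(y_{r+1},\dots,y_n)$ is a basis of $\ker A$, $(x_1,\dots,x_r)$ is a basis of $\operatorname{im}A$, and $Ay_i=x_i$ for $i\le r$. Such decompositions exist. For $k\ge0$, let $\partial_k=\partial_C|_{C_k}$ and take a singular value decomposition of $\partial_{k+1}:C_{k+1}\to\ker\partial_k$; the degree-$k$ verbose barcode $\mathcal{B}_{\mathrm{Ver},k}(C_* )$ is the multiset of pairs $(\ell_C(x_i),\ell_C(y_i))$ for $1\le i\le r=\operatorname{rank}\partial_{k+1}$ and $(\ell_C(x_i),\infty)$ for $r<i\le m=\dim\ker\partial_k$. It does not depend on the choice of decomposition. Matching distance. For pairs, $\|(p,q)-(p',q')\|_\infty=\max\{|p-p'|,|q-q'|\}$ if $q,q'<\infty$, $=|p-p'|$ if $q=q'=\infty$, and $=\infty$ otherwise. For multisets $A,B$, $d_{\mathrm M}(A,B)=\inf_\phi\sup_{a\in A}\|a-\phi(a)\|_\infty$ over all bijections of multisets $\phi:A\to B$ (copies of a repeated element are treated as distinct); it is $\infty$ if the cardinalities differ and $0$ if both are empty. Interleaving distance. For $t\in\mathbb{R}$ let $C_*^t=\{x\in C_*:\ell_C(x)\le t\}$, a subcomplex. Two FCCs are $\delta$-interleaved ($\delta\ge0$) if there are chain maps $f_t:C_*^t\to D_*^{t+\delta}$ and $g_t:D_*^t\to C_*^{t+\delta}$ for all $t\in\mathbb{R}$,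 commuting with the inclusions $C_*^t\hookrightarrow C_*^{t'}$, $D_*^t\hookrightarrow D_*^{t'}$ for $t\le t'$, such that $g_{t+\delta}\circ f_t$ and $f_{t+\delta}\circ g_t$ equal the inclusions $C_*^t\hookrightarrow C_*^{t+2\delta}$ and $D_*^t\hookrightarrow D_*^{t+2\delta}$. $d_{\mathrm I}$ is the infimum of such $\delta$ ($\inf\emptyset=\infty$). *)

(* Defs.v *)
From HB Require Import structures.
From mathcomp Require Import all_boot all_order all_algebra.
From mathcomp Require Import boolp classical_sets reals constructive_ereal ereal.

Set Implicit Arguments.
Unset Strict Implicit.
Unset Printing Implicit Defensive.

Import Order.TTheory GRing.Theory Num.Theory.
Local Open Scope ring_scope.

(* Values in the real line with -oo (resp. +oo) adjoined are taken in [\bar R]. *)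

Record filtration_function (F : fieldType) (R : realType) (V : vectType F)
    (l : V -> \bar R) : Prop := FiltrationFunction {
  filt_fun_lty : forall x, (l x < +oo)%E;
  filt_fun_eqNy : forall x, l x = -oo%E <-> x = 0;
  filt_funZ : forall (a : F) x, a != 0 -> l (a *: x) = l x;
  filt_funD : forall x y, (l (x + y)%R <= maxe (l x) (l y))%E
}.

(* The maximum over an empty support is -oo, the value at the zero vector. *)
Definition filt_orthogonal (F : fieldType) (R : realType) (V : vectType F)
    (l : V -> \bar R) (s : seq V) : Prop :=
  forall a : 'I_(size s) -> F,
    l (\sum_(i < size s) a i *: s`_i) =
    \big[maxe/-oo%E]_(i < size s | a i != 0) l s`_i.

Definition orthogonal_basis (F : fieldType) (R : realType) (V : vectType F)
    (l : V -> \bar R) (s : seq V) : Prop :=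
  basis_of fullv s /\ filt_orthogonal l s.

Definition orthogonalizable (F : fieldType) (R : realType) (V : vectType F)
    (l : V -> \bar R) : Prop :=
  exists s, orthogonal_basis l s.

(* [bd k] is the boundary from degree k.+1 to degree k; the boundary on degree
   0 is zero. The filtration is given degreewise, its value on a sum of
   homogeneous elements being the maximum of the values on the summands, so
   that all conditions can be checked degree by degree. *)
Record FCC (F : fieldType) (R : realType) := MkFCC {
  chain : nat -> vectType F;
  bd : forall k, 'Hom(chain k.+1, chain k);
  filt : forall k, chain k -> \bar R;
  bd_bd : forall k x, bd k (bd k.+1 x) = 0;
  chain_fin :
    exists M : nat, forall n, (\sum_(k < n) \dim {:chain k} <= M)%N;
  filtP : forall k, filtration_function (@filt k);
  filt_orth : forall k, orthogonalizable (@filt k);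
  filt_bd : forall k x, (filt (bd k x) <= filt x)%E
}.

Definition cycles (F : fieldType) (R : realType) (C : FCC F R) (k : nat) :
    {vspace chain C k} :=
  match k return {vspace chain C k} with
  | 0 => fullv
  | k'.+1 => lker (bd C k')
  end.

(* [bd C k] with its codomain restricted to the cycles: the projection
   [vsproj] is the identity on the cycles, which contain the image of the
   boundary. *)
Definition bd_cycles (F : fieldType) (R : realType) (C : FCC F R) (k : nat) :
    'Hom(chain C k.+1, subvs_of (cycles C k)) :=
  (linfun (vsproj (cycles C k)) \o bd C k)%VF.

Definition filt_cycles (F : fieldType) (R : realType) (C : FCC F R) (k : nat)
    (x : subvs_of (cycles C k)) : \bar R :=
  filt (vsval x).

Record is_svd (F : fieldType) (R : realType) (V W : vectType F)
    (lV : V -> \bar R) (lW : W -> \bar R) (A : 'Hom(V, W))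
    (ys : seq V) (xs : seq W) : Prop := IsSVD {
  svd_domain : orthogonal_basis lV ys;
  svd_codomain : orthogonal_basis lW xs;
  svd_ker : basis_of (lker A) (drop (\dim (limg A)) ys);
  svd_im : basis_of (limg A) (take (\dim (limg A)) xs);
  svd_map : forall i, (i < \dim (limg A))%N -> A ys`_i = xs`_i
}.

(* Multisets of bars are represented by lists, up to reordering. The left
   endpoint is the filtration level of a basis vector, hence finite, so that
   [fine] loses nothing. *)
Definition is_verbose_barcode (F : fieldType) (R : realType) (C : FCC F R)
    (k : nat) (B : seq (R * \bar R)) : Prop :=
  exists ys xs,
    is_svd (@filt _ _ C k.+1) (@filt_cycles _ _ C k) (bd_cycles C k) ys xs /\
    B = [seq (fine (filt_cycles xs`_i),
              if (i < \dim (limg (bd_cycles C k)))%N then filt ys`_i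
              else +oo%E)
        | i <- iota 0 (size xs)].

(* The barcode read off from a chosen singular value decomposition of
   [bd_cycles C k]; such decompositions always exist, so the default value of
   [xget] is irrelevant. *)
Definition verbose_barcode (F : fieldType) (R : realType) (C : FCC F R)
    (k : nat) : seq (R * \bar R) :=
  xget [::] [set B | is_verbose_barcode C k B]%classic.

(* Right endpoints are never -oo. *)
Definition bar_dist (R : realType) (a b : R * \bar R) : \bar R :=
  match a.2, b.2 with
  | q%:E, q'%:E => (Num.max `|a.1 - b.1| `|q - q'|)%:E
  | +oo, +oo => `|a.1 - b.1|%:E
  | _, _ => +oo
  end%E.

(* Bijections of positions, so that copies of a repeated bar are distinct; the
   supremum over no bar at all is 0, and [ereal_inf] of the empty set is +oo. *)
Definition matching_dist (R : realType) (A B : seq (R * \bar R)) : \bar R :=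
  ereal_inf
    [set \big[maxe/0%E]_(i < size A)
           bar_dist (nth (0, +oo%E) A i) (nth (0, +oo%E) B (phi i))
    | phi in [set phi : 'I_(size A) -> 'I_(size B) | bijective phi]]%classic.

Definition sublevel (F : fieldType) (R : realType) (C : FCC F R) (k : nat)
    (t : R) : {pred chain C k} :=
  fun x => (filt x <= t%:E)%E.

Lemma sublevel_submod_closed (F : fieldType) (R : realType) (C : FCC F R)
  (k : nat) (t : R) : submod_closed (@sublevel F R C k t).
Proof.
have [_ l0 lZ lD] := filtP C k.
have s0 : (0 : chain C k) \in @sublevel F R C k t.
  by rewrite unfold_in /sublevel (proj2 (l0 0) erefl) leNye.
split=> // a x y; rewrite !unfold_in /sublevel => xt yt.
apply: le_trans (lD _ _) _; rewrite ge_max yt andbT.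
have [->|a0] := eqVneq a 0; last by rewrite lZ.
by rewrite scale0r (proj2 (l0 0) erefl) leNye.
Qed.

HB.instance Definition _ (F : fieldType) (R : realType) (C : FCC F R)
    (k : nat) (t : R) :=
  GRing.isSubmodClosed.Build F (chain C k) (@sublevel F R C k t)
    (@sublevel_submod_closed F R C k t).

Record sub_chain (F : fieldType) (R : realType) (C : FCC F R) (t : R)
    (k : nat) := SubChain {
  sub_chain_val : chain C k;
  sub_chainP : sub_chain_val \in @sublevel F R C k t
}.

HB.instance Definition _ (F : fieldType) (R : realType) (C : FCC F R) (t : R)
  (k : nat) := [isSub for @sub_chain_val F R C t k].
HB.instance Definition _ (F : fieldType) (R : realType) (C : FCC F R) (t : R)
  (k : nat) := [Choice of sub_chain C t k by <:].
HB.instance Definition _ (F : fieldType) (R : realType) (C : FCC F R) (t : R)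
  (k : nat) := [SubChoice_isSubLmodule of sub_chain C t k by <:].

Lemma sub_bd_subproof (F : fieldType) (R : realType) (C : FCC F R) (t : R)
  (k : nat) (x : sub_chain C t k.+1) : bd C k (sub_chain_val x) \in @sublevel F R C k t.
Proof. exact: le_trans (filt_bd _) (sub_chainP x). Qed.

Definition sub_bd (F : fieldType) (R : realType) (C : FCC F R) (t : R)
    (k : nat) (x : sub_chain C t k.+1) : sub_chain C t k :=
  SubChain (sub_bd_subproof x).

Lemma sub_incl_subproof (F : fieldType) (R : realType) (C : FCC F R)
  (t t' : R) (k : nat) (tt' : t <= t') (x : sub_chain C t k) :
  sub_chain_val x \in @sublevel F R C k t'.
Proof. by apply: le_trans (sub_chainP x) _; rewrite lee_fin. Qed.

Definition sub_incl (F : fieldType) (R : realType) (C : FCC F R) (t t' : R)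
    (k : nat) (tt' : t <= t') (x : sub_chain C t k) : sub_chain C t' k :=
  SubChain (sub_incl_subproof tt' x).

Record shift_map (F : fieldType) (R : realType) (C D : FCC F R) (delta : R) :=
    ShiftMap {
  smap :> forall (t : R) (k : nat),
    {linear sub_chain C t k -> sub_chain D (t + delta) k};
  smap_bd : forall t k (x : sub_chain C t k.+1),
    smap t k (sub_bd x) = sub_bd (smap t k.+1 x);
  smap_incl : forall t t' k (tt' : t <= t') (x : sub_chain C t k),
    smap t' k (sub_incl tt' x) =
    sub_incl (lerD tt' (lexx delta)) (smap t k x)
}.

Lemma le_shift2 (R : realType) (delta t : R) :
  0 <= delta -> t <= t + delta + delta.
Proof. by move=> d0; rewrite -addrA lerDl addr_ge0. Qed.

Definition interleaved (F : fieldType) (R : realType) (C D : FCC F R)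
    (delta : R) : Prop :=
  exists (d0 : 0 <= delta) (f : shift_map C D delta) (g : shift_map D C delta),
    (forall t k (x : sub_chain C t k),
       g (t + delta) k (f t k x) = sub_incl (le_shift2 t d0) x) /\
    (forall t k (y : sub_chain D t k),
       f (t + delta) k (g t k y) = sub_incl (le_shift2 t d0) y).

Definition interleaving_dist (F : fieldType) (R : realType) (C D : FCC F R) :
    \bar R :=
  ereal_inf [set delta%:E | delta in [set delta | interleaved C D delta]]%classic.

(* Main.v *)
Require Import Defs.
From HB Require Import structures.
From mathcomp Require Import all_boot all_order all_fingroup all_algebra.
From mathcomp Require Import lra.
From mathcomp Require Import boolp classical_sets reals constructive_ereal ereal.

(* A [d]-interleaving amounts to a chain isomorphism that moves the filtration
   levels by at most [d] in both directions.

   Such an isomorphism gives a matching of bars. Expanding the image of one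
   singular basis in the other gives an invertible matrix; a permutation whose
   entries are all nonzero bounds each target bar by a source bar plus [d], but
   only in one direction, and for points of the plane one-sided bijections in
   both directions need not yield a two-sided one. So the endpoints are moved
   one at a time, through the singular value decomposition of the same boundary
   map for the mixed pair of filtrations (the source one on chains, the target
   one on cycles). While one endpoint stays exactly fixed, listing the bars in
   lexicographic order turns the two one-sided bijections into a matching.

   Conversely, matchings transport the singular bases degree by degree. The
   chains of degree [k] split orthogonally as the cycles plus the span of the
   vectors whose boundaries are the singular vectors of degree [k - 1], so the
   matchings in degrees [k] and [k - 1] together define the isomorphism in
   degree [k]. *)

Set Implicit Arguments.
Unset Strict Implicit.
Unset Printing Implicit Defensive.

Import Order.TTheory GRing.Theory Num.Theory.
Local Open Scope ring_scope.

(** * Orthogonal families for a filtration function *)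

Lemma perm_cat_cons (T : eqType) (s1 : seq T) x s2 :
  perm_eq (s1 ++ x :: s2) (x :: s1 ++ s2).
Proof. by rewrite -cat1s perm_catCA. Qed.

Section FiltrationFunction.
Context (F : fieldType) (R : realType) (V : vectType F) (l : V -> \bar R).
Context (lP : filtration_function l).

Lemma filt_fun0 : l 0 = -oo%E.
Proof. by apply/(filt_fun_eqNy lP). Qed.

Lemma filt_funZ_le (a : F) x : (l (a *: x) <= l x)%E.
Proof.
have [->|a0] := eqVneq a 0; first by rewrite scale0r filt_fun0 leNye.
by rewrite (filt_funZ lP).
Qed.

Lemma filt_funN x : l (- x) = l x.
Proof. by rewrite -scaleN1r (filt_funZ lP) // oppr_eq0 oner_eq0. Qed.

Lemma filt_fun_fin x : x != 0 -> l x \is a fin_num.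
Proof.
move=> x0; rewrite fin_numElt (filt_fun_lty lP) andbT ltNye.
by apply: contra_neq x0 => /(filt_fun_eqNy lP).
Qed.

Lemma filt_funB x y : (l (x - y)%R <= maxe (l x) (l y))%E.
Proof. by rewrite -(filt_funN y); exact: (filt_funD lP). Qed.

Lemma filt_fun_sum I (r : seq I) (P : pred I) (f : I -> V) (M : \bar R) :
  (forall i, P i -> (l (f i) <= M)%E) -> (l (\sum_(i <- r | P i) f i) <= M)%E.
Proof.
move=> fM; elim/big_ind: _ => //; first by rewrite filt_fun0 leNye.
by move=> x y xM yM; apply: le_trans (filt_funD lP _ _) _; rewrite ge_max xM.
Qed.

(** The level of a sum never exceeds the largest level of its terms, so orthogonality only asks that
    no term which occurs lies above the sum. *)
Lemma filt_orthogonalP s : filt_orthogonal l s <->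
  (forall (a : 'I_(size s) -> F) i,
     a i != 0 -> (l s`_i <= l (\sum_(j < size s) a j *: s`_j)%R)%E).
Proof.
split=> [o a i ai|o a]; first by rewrite o; exact: le_bigmax_cond.
apply/eqP; rewrite eq_le; apply/andP; split.
  rewrite (bigID (fun i => a i != 0)) /= addrC big1 ?add0r; last first.
    by move=> i /negPn/eqP ->; rewrite scale0r.
  apply: filt_fun_sum => i ai; rewrite (filt_funZ lP) //.
  exact: le_bigmax_cond.
by apply: bigmax_le => [|i ai]; [exact: leNye | exact: o].
Qed.

Lemma sum_nth_cons (x : V) s (a : 'I_(size s).+1 -> F) :
  \sum_(j < size (x :: s)) a j *: (x :: s)`_j =
  a ord0 *: x + \sum_(j < size s) a (lift ord0 j) *: s`_j.
Proof. exact: big_ord_recl. Qed.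

(** The recursive form of orthogonality, on which the inductions run. Scaling normalises a nonzero
    coefficient of [x] to 1. The terms in [s] lie below the partial sum [u], and [u] is the whole
    sum minus a multiple of [x], both of which are controlled. *)
Lemma filt_orthogonal_cons x s : filt_orthogonal l (x :: s) <->
  filt_orthogonal l s /\ (forall u, u \in <<s>>%VS -> (l x <= l (x + u)%R)%E).
Proof.
split=> [/filt_orthogonalP o|[/filt_orthogonalP o xs]].
  split.
    apply/filt_orthogonalP => a i ai.
    pose b (j : 'I_(size (x :: s))) :=
      if unlift ord0 j is Some j' then a j' else 0.
    have := o b (lift ord0 i); rewrite sum_nth_cons /b liftK /= unlift_none.
    rewrite scale0r add0r => /(_ ai).
    by under eq_bigr do rewrite liftK.
  move=> u us.
  (* The coefficients of [x + u]: 1 at the head, the coordinates of [u] on the tail. *)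
  pose b (j : 'I_(size (x :: s))) :=
    if unlift ord0 j is Some j' then coord (in_tuple s) j' u else 1.
  have := o b ord0; rewrite sum_nth_cons /b unlift_none scale1r oner_eq0 /=.
  move=> /(_ isT); under eq_bigr do rewrite liftK.
  by rewrite -(coord_span (X := in_tuple s) us).
apply/filt_orthogonalP => a i ai.
rewrite sum_nth_cons; set u := \sum_(_ < _) _.
have us : u \in <<s>>%VS.
  by apply: rpred_sum => j _; rewrite memvZ // memv_span // mem_nth.
have xau : a ord0 != 0 -> (l x <= l (a ord0 *: x + u)%R)%E.
  move=> a0; rewrite -[leRHS](filt_funZ lP _ (invr_neq0 a0)).
  rewrite scalerDr scalerA mulVf //.
  by rewrite scale1r xs // memvZ.
case: (unliftP ord0 i) ai => [j ->|->] //= aj.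
apply: le_trans (o (fun j => a (lift ord0 j)) j aj) _; rewrite -/u.
have {1}-> : u = (a ord0 *: x + u) - a ord0 *: x by rewrite addrC addKr.
apply: le_trans (filt_funB _ _) _; rewrite ge_max lexx /=.
have [->|a0] := eqVneq (a ord0) 0; first by rewrite scale0r filt_fun0 leNye.
by rewrite (filt_funZ lP) // xau.
Qed.

(** In [y + (c *: x + v)] the term [c *: x] lies below the sum because [x] is orthogonal to the
    rest; removing it bounds [y + v], and hence [y]. *)
Lemma filt_orthogonal_swap x y s :
  filt_orthogonal l [:: x, y & s] -> filt_orthogonal l [:: y, x & s].
Proof.
move=> /filt_orthogonal_cons[/filt_orthogonal_cons[os ys] xys].
apply/filt_orthogonal_cons; split.
  apply/filt_orthogonal_cons; split=> // u us; apply: xys.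
  by rewrite span_cons (subvP (addvSr _ _)).
move=> u; rewrite span_cons => /memv_addP[_ /vlineP[c ->]] [v vs ->].
apply: le_trans (ys _ vs) _.
have -> : y + v = (y + (c *: x + v)) - c *: x.
  by rewrite (addrCA y) (addrC (c *: x)) addrK.
apply: le_trans (filt_funB _ _) _; rewrite ge_max lexx /=.
have [->|c0] := eqVneq c 0; first by rewrite scale0r filt_fun0 leNye.
rewrite (filt_funZ lP) // -[leRHS](filt_funZ lP _ (invr_neq0 c0)).
rewrite addrCA scalerDr scalerA mulVf // scale1r; apply: xys.
by rewrite memvZ // span_cons memv_add // memv_line.
Qed.

Lemma filt_orthogonal_behead x s :
  filt_orthogonal l (x :: s) -> filt_orthogonal l s.
Proof. by case/filt_orthogonal_cons. Qed.

Lemma filt_orthogonal_front s1 x s2 :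
  filt_orthogonal l (s1 ++ x :: s2) -> filt_orthogonal l (x :: s1 ++ s2).
Proof.
elim: s1 => //= z s1 IH /filt_orthogonal_cons[/IH o1 zs].
apply: filt_orthogonal_swap; apply/filt_orthogonal_cons; split=> // u us.
apply: zs; move: us; rewrite (@eq_span _ _ _ (s1 ++ x :: s2)) //.
by apply: perm_mem; rewrite perm_sym perm_cat_cons.
Qed.

Lemma perm_filt_orthogonal s t :
  perm_eq s t -> filt_orthogonal l s -> filt_orthogonal l t.
Proof.
elim: t s => [|x t IH] s st; first by rewrite (perm_nilP st).
have xs : x \in s by rewrite (perm_mem st) mem_head.
case/splitPr: xs st => s1 s2.
rewrite (permPl (perm_cat_cons _ _ _)) perm_cons => st.
move=> /filt_orthogonal_front/filt_orthogonal_cons[o xs].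
apply/filt_orthogonal_cons; split; first exact: IH st o.
by move=> u; rewrite -(eq_span (perm_mem st)); exact: xs.
Qed.

(** The level of [x] is least on the coset of [x] modulo the span of [s]. A vector [v] of that span
    lying no higher than [x] keeps the level, and the new vector is again minimal on its coset. This
    is the elementary operation of orthogonal elimination. *)
Lemma filt_orthogonal_shear x s c v : c != 0 -> v \in <<s>>%VS ->
  (l v <= l x)%E -> filt_orthogonal l (x :: s) ->
  filt_orthogonal l (c *: x + v :: s) /\ l (c *: x + v) = l x.
Proof.
move=> c0 vs vx /filt_orthogonal_cons[os xs].
have xcv u : u \in <<s>>%VS -> (l x <= l (c *: x + u)%R)%E.
  move=> us; rewrite -[leRHS](filt_funZ lP _ (invr_neq0 c0)).
  by rewrite scalerDr scalerA mulVf // scale1r xs // memvZ.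
have lcxv : l (c *: x + v) = l x.
  apply/eqP; rewrite eq_le xcv // andbT.
  by apply: le_trans (filt_funD lP _ _) _; rewrite ge_max filt_funZ_le.
split=> //; apply/filt_orthogonal_cons; split=> // u us.
by rewrite lcxv -addrA xcv // memvD.
Qed.

(** The pivot is a term of highest level in the expansion of [w], whose level is that of [w]. The
    head serves if it occurs and dominates the remainder; otherwise the remainder carries the level
    and the search continues there. *)
Lemma filt_orthogonal_pivot s w :
  filt_orthogonal l s -> w \in <<s>>%VS -> w != 0 ->
  exists x s' c, [/\ perm_eq s (x :: s'), c != 0, w - c *: x \in <<s'>>%VS &
    l w = l x].
Proof.
elim: s w => [|z s IH] w; first by rewrite span_nil memv0 => _ ->.
move=> /[dup] ozs /filt_orthogonal_cons[os zs].
rewrite span_cons => /memv_addP[_ /vlineP[a ->]] [u us ->] w0.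
have [/andP[a0 uz]|naz] := boolP ((a != 0) && (l u <= l z)%E).
  exists z, s, a; split=> //; first by rewrite addrC addKr.
  by have [_] := filt_orthogonal_shear a0 us uz ozs.
have u0 : u != 0.
  apply: contra naz => /eqP u0; rewrite u0 filt_fun0 leNye andbT.
  by apply: contra_neq w0 => ->; rewrite scale0r u0 addr0.
have [x [s' [c [ps c0 ucx lux]]]] := IH u os us u0.
exists x, (z :: s'), c; split=> //.
- rewrite (perm_trans (y := [:: z, x & s'])) ?perm_cons //.
  exact: (perm_cat_cons [:: z]).
- by rewrite -addrA span_cons memv_add // memvZ // memv_line.
(* A strictly lower summand does not change the level of [u]. *)
rewrite -lux; have [->|a0] := eqVneq a 0; first by rewrite scale0r add0r.
have zu : (l z < l u)%E by move: naz; rewrite a0 /= -ltNge.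
have azu : (l (a *: z) < l u)%E by rewrite (filt_funZ lP).
apply/eqP; rewrite eq_le; apply/andP; split.
  by apply: le_trans (filt_funD lP _ _) _; rewrite ge_max lexx ltW.
have : (l u <= maxe (l (a *: z + u)%R) (l (a *: z)))%E.
  by rewrite -{1}(addKr (a *: z) u) addrC filt_funB.
by rewrite le_max => /orP[//|]; rewrite leNgt azu.
Qed.

End FiltrationFunction.

(** * Existence of singular value decompositions *)

Section SVDExists.
Context (F : fieldType) (R : realType) (V W : vectType F)
  (lV : V -> \bar R) (lW : W -> \bar R) (A : 'Hom(V, W)).
Context (lVP : filtration_function lV) (lWP : filtration_function lW).

(** Clearing the pivot column: each [z] becomes [z - g *: y], a shear that keeps its level because
    [y] lies no higher than [z]. Equality of the lists of levels keeps the rows sorted for the next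
    round. *)
Lemma filt_orthogonal_shear_all y ys (U : {vspace W}) :
  (forall z, z \in ys -> (lV y <= lV z)%E) ->
  (forall z, z \in ys -> exists g : F, A z - g *: A y \in U) ->
  filt_orthogonal lV (y :: ys) ->
  exists ys', [/\ filt_orthogonal lV (y :: ys'),
    <<y :: ys'>>%VS = <<y :: ys>>%VS, map lV ys' = map lV ys &
    forall z, z \in ys' -> A z \in U].
Proof.
elim: ys => [|z ys IH] yle Uys o; first by exists [::].
have /filt_orthogonal_cons[//|oy zy] := filt_orthogonal_swap lVP o.
have [||//|ys' [o' sp' l' U']] := IH.
- by move=> t tys; apply: yle; rewrite inE tys orbT.
- by move=> t tys; apply: Uys; rewrite inE tys orbT.
have [g zU] := Uys z (mem_head _ _).
have oz : filt_orthogonal lV (z :: y :: ys').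
  by apply/filt_orthogonal_cons => //; split=> // u; rewrite sp'; exact: zy.
have yle' : (lV (- g *: y) <= lV z)%E.
  by apply: le_trans (filt_funZ_le lVP _ _) _; exact/yle/mem_head.
have ysp : - g *: y \in <<y :: ys'>>%VS.
  by rewrite memvZ // memv_span // mem_head.
have [o2 l2] := filt_orthogonal_shear lVP (oner_neq0 F) ysp yle' oz.
exists (1 *: z - g *: y :: ys'); split.
- by rewrite -scaleNr; exact: filt_orthogonal_swap.
- have E t (s : seq V) : <<y :: t :: s>>%VS = (<[t]> + <<y :: s>>)%VS.
    by rewrite !span_cons addvA (addvC <[y]>%VS) -addvA.
  rewrite !E -{}sp'; apply/eqP; rewrite eqEsubv !subv_add !addvSr !andbT.
  rewrite -!memvE scale1r -scaleNr; apply/andP; split.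
    by rewrite memv_add // memv_line.
  rewrite -{1}(addrK (- g *: y) z) memv_add ?memv_line //.
  by rewrite memvN.
- by rewrite /= l' -scaleNr l2.
move=> t; rewrite inE => /predU1P[->|]; last exact: U'.
by rewrite scale1r linearB linearZ.
Qed.

(* Gaussian elimination that stays orthogonal: the row [y] used to clear the
   others has the least level, and the pivot column is one of the highest level
   in the support of [A y], namely that of [A y] itself. *)
Lemma exists_svd_sorted ys xs :
  sorted (fun y z => (lV y <= lV z)%E) ys ->
  filt_orthogonal lV ys -> filt_orthogonal lW xs ->
  (forall y, y \in ys -> A y \in <<xs>>%VS) ->
  exists y1 y2 x2,
    [/\ filt_orthogonal lV (y1 ++ y2), <<y1 ++ y2>>%VS = <<ys>>%VS &
        size (y1 ++ y2) = size ys] /\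
    [/\ filt_orthogonal lW (map A y1 ++ x2),
        <<map A y1 ++ x2>>%VS = <<xs>>%VS, size (map A y1 ++ x2) = size xs &
        forall y, y \in y2 -> A y = 0].
Proof.
have [n] := ubnP (size ys); elim: n => // n IH in ys xs *.
case: ys => [|y ys] /= ltn; first by move=> *; exists [::], [::], xs.
have tr : transitive (fun y z => (lV y <= lV z)%E).
  by move=> ? ? ?; exact: le_trans.
move=> so oy ox Axs.
have yle z : z \in ys -> (lV y <= lV z)%E.
  by move: so; rewrite path_sortedE // => /andP[/allP/(_ z)].
have [Ay0|Ay0] := eqVneq (A y) 0.
  have [||||y1 [y2 [x2 [[o1 s1 z1] [o2 s2 z2 K]]]]] := IH ys xs ltn.
  - exact: path_sorted so.
  - exact: filt_orthogonal_behead oy.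
  - by [].
  - by move=> z zy; apply: Axs; rewrite inE zy orbT.
  have pe : perm_eq (y :: y1 ++ y2) (y1 ++ y :: y2).
    by rewrite perm_sym perm_cat_cons.
  exists y1, (y :: y2), x2; split; split=> //.
  - apply: perm_filt_orthogonal pe _ => //.
    case/filt_orthogonal_cons: oy => // _ yys.
    by apply/filt_orthogonal_cons => //; split=> // u; rewrite s1; exact: yys.
  - by rewrite -(eq_span (perm_mem pe)) !span_cons s1.
  - by rewrite -z1 -(perm_size pe).
  - by move=> z; rewrite inE => /predU1P[->|/K].
have [x [xs' [c [pxs c0 wxs lwx]]]] :=
  filt_orthogonal_pivot lWP ox (Axs _ (mem_head _ _)) Ay0.
have ox' := perm_filt_orthogonal lWP pxs ox.
(* [A y] is the shear of the pivot [x] by the other terms of its expansion, so it can replace [x] in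
   the orthogonal family. *)
have vle : (lW (A y - c *: x) <= lW x)%E.
  apply: le_trans (filt_funB lWP _ _) _.
  by rewrite ge_max lwx lexx filt_funZ_le.
have [] := filt_orthogonal_shear lWP c0 wxs vle ox'.
rewrite addrC subrK => oAy _.
have spA : <<A y :: xs'>>%VS = <<xs>>%VS.
  rewrite (eq_span (perm_mem pxs)) !span_cons; apply/eqP.
  rewrite eqEsubv !subv_add !addvSr !andbT -!memvE; apply/andP; split.
    by rewrite -(subrK (c *: x) (A y)) addrC memv_add // memvZ // memv_line.
  rewrite -(scale1r x) -(mulVf c0) -scalerA memvZ //.
  rewrite -(subKr (A y) (c *: x)) memv_add ?memv_line //.
  by rewrite memvN.
have [||//|ys' [oys' spys' lys' Ays']] :=
  @filt_orthogonal_shear_all y ys <<xs'>>%VS.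
- by [].
(* The multiplier [g] is the coefficient of [A z] along [A y] in the new family. *)
- move=> z zys; have : A z \in <<A y :: xs'>>%VS.
    by rewrite spA Axs // inE zys orbT.
  rewrite span_cons => /memv_addP[_ /vlineP[g ->]] [u us ->].
  by exists g; rewrite addrC addKr.
have szys' : size ys' = size ys by rewrite -(size_map lV) lys' size_map.
have [|||||y1 [y2 [x2 [[o1 s1 z1] [o2 s2 z2 K]]]]] := IH ys' xs'.
- by rewrite szys'.
- move: (path_sorted so).
  have E s : sorted (fun y z => (lV y <= lV z)%E) s =
    sorted (fun a b => (a <= b)%E) (map lV s) by rewrite sorted_map.
  by rewrite !E lys'.
- exact: filt_orthogonal_behead oys'.
- exact: filt_orthogonal_behead ox'.
- by [].
exists (y :: y1), y2, x2; split; split=> //=.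
- case/filt_orthogonal_cons: oys' => // _ yys.
  by apply/filt_orthogonal_cons => //; split=> // u; rewrite s1; exact: yys.
- by rewrite -spys' !span_cons s1.
- by rewrite z1 szys'.
- case/filt_orthogonal_cons: oAy => // _ yys.
  by apply/filt_orthogonal_cons => //; split=> // u; rewrite s2; exact: yys.
- by rewrite -spA !span_cons s2.
- by rewrite z2 (perm_size pxs).
Qed.

(** The elimination preserves spans and lengths, so its output lists are bases. The images of [y1]
    are free and span the image of [A], and rank-nullity then shows that [y2] spans the kernel. *)
Lemma exists_svd : orthogonalizable lV -> orthogonalizable lW ->
  exists ys xs, is_svd lV lW A ys xs.
Proof.
move=> [ys0 [bys oys]] [xs [bxs oxs]].
pose leV y z := (lV y <= lV z)%E; pose ys := sort leV ys0.
have tot : total leV by move=> y z; exact: le_total.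
have pys : perm_eq ys0 ys by rewrite perm_sym perm_sort.
have [||||y1 [y2 [x2 [[o1 s1 z1] [o2 s2 z2 K]]]]] := @exists_svd_sorted ys xs.
- exact: sort_sorted.
- exact: perm_filt_orthogonal oys.
- by [].
- by move=> y _; rewrite (span_basis bxs) memvf.
have bV : basis_of fullv (y1 ++ y2).
  by move: bys; rewrite (perm_basis _ pys) !basisEdim s1 z1.
have bW : basis_of fullv (map A y1 ++ x2).
  by move: bxs; rewrite !basisEdim s2 z2.
have imE : limg A = <<map A y1>>%VS.
  rewrite -(span_basis bV) limg_span map_cat span_cat.
  apply/addv_idPl/span_subvP => _ /mapP[z zy2 ->].
  by rewrite K ?mem0v.
have fA : free (map A y1) by apply: (@catl_free _ _ x2); exact: basis_free bW.
have dimA : \dim (limg A) = size y1.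
  by rewrite imE -(size_map A y1); apply/eqP.
exists (y1 ++ y2), (map A y1 ++ x2); split; rewrite ?dimA.
- by [].
- by [].
- rewrite drop_size_cat // basisEfree; apply/and3P; split.
  + by apply: (@catr_free _ _ y1); exact: basis_free bV.
  + by apply/span_subvP => z /K Az; rewrite memv_ker Az.
  + have := limg_ker_dim A fullv; rewrite capfv dimA.
    have -> : \dim {:V} = (size y1 + size y2)%N.
      by rewrite -size_cat; exact: (size_basis (X := in_tuple (y1 ++ y2))).
    by rewrite addnC => /addnI ->.
- rewrite take_size_cat ?size_map // imE.
  by rewrite basisEfree fA subvv (eqP fA) leqnn.
move=> i iy1; rewrite !nth_cat size_map iy1 (nth_map 0) //.
Qed.

End SVDExists.

(** * Combining one-sided bijections by sorting *)

Section SortedMatching.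
Context (T : Type) (leT : rel T).
Context (leT_total : total leT) (leT_trans : transitive leT).

Lemma sorting_perm n (a : 'I_n -> T) :
  exists p : {perm 'I_n},
    forall i j : 'I_n, (i <= j)%N -> leT (a (p i)) (a (p j)).
Proof.
pose r := relpre a leT; pose s := sort r (enum 'I_n).
have sz : size s = n by rewrite size_sort size_enum_ord.
have us : uniq s by rewrite sort_uniq enum_uniq.
have inj : injective (fun i : 'I_n => nth i s i).
  move=> i j /eqP; rewrite (set_nth_default i j) ?sz // nth_uniq ?sz //.
  by move=> /eqP/val_inj.
exists (perm inj) => i j; rewrite !permE (set_nth_default i j) ?sz //.
apply: (sorted_leq_nth (leT := r)) => //; rewrite ?inE ?sz //.
- by move=> x y z; exact: leT_trans.
- by move=> x; have := leT_total (a x) (a x); rewrite orbb.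
by apply: sort_sorted => x y; exact: leT_total.
Qed.

(** A counting argument. If the bound fails at [k], every [i] with [b i] below [f (a (p k))] is
    among the first [k] positions of [q]; yet [s] sends the first [k + 1] positions of [p]
    injectively to such indices. *)
Lemma sorted_dominated n (f : T -> T) (a b : 'I_n -> T) (p q : {perm 'I_n})
    (s : 'I_n -> 'I_n) :
  {homo f : x y / leT x y} -> injective s ->
  (forall i j : 'I_n, (i <= j)%N -> leT (a (p i)) (a (p j))) ->
  (forall i j : 'I_n, (i <= j)%N -> leT (b (q i)) (b (q j))) ->
  (forall i, leT (b (s i)) (f (a i))) ->
  forall k, leT (b (q k)) (f (a (p k))).
Proof.
move=> f_homo s_inj ap bq bsa k; apply: contraT => nle.
pose S := [set i | leT (b i) (f (a (p k)))].
have lt_card m : (m <= n)%N -> #|[set l : 'I_n | (l < m)%N]| = m.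
  move=> mn; rewrite -sum1dep_card -(big_ord_widen n (fun=> 1%N)) //.
  by rewrite sum1_card card_ord.
have Sle : (#|S| <= k)%N.
  rewrite -[leqRHS](lt_card k (ltnW (ltn_ord k))).
  rewrite -[leqRHS](card_imset _ (@perm_inj _ q)).
  apply/subset_leq_card/fintype.subsetP => i; rewrite inE => Si.
  apply/imsetP; exists ((q^-1)%g i); last by rewrite permKV.
  rewrite inE ltnNge; apply: contra nle => kq.
  by apply: leT_trans Si; rewrite -[in leT _ _](permKV q i); exact: bq.
have : (k < #|S|)%N.
  rewrite -[leqLHS](lt_card k.+1 (ltn_ord k)).
  rewrite -[leqLHS](card_imset _ (@perm_inj _ p)) -[leqLHS](card_imset _ s_inj).
  apply/subset_leq_card/fintype.subsetP => i.
  move=> /imsetP[_ /imsetP[l + ->] ->]; rewrite !inE ltnS => lk.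
  by apply: leT_trans (bsa _) _; exact/f_homo/ap.
by rewrite ltnNge Sle.
Qed.

(** Both families are sorted and their entries of equal rank are paired; each one-sided bijection
    then yields one of the two inequalities. *)
Lemma one_sided_matchings n (f : T -> T) (a b : 'I_n -> T)
    (s t : 'I_n -> 'I_n) :
  {homo f : x y / leT x y} -> injective s -> injective t ->
  (forall i, leT (b (s i)) (f (a i))) -> (forall i, leT (a (t i)) (f (b i))) ->
  exists u : {perm 'I_n},
    forall i, leT (b (u i)) (f (a i)) /\ leT (a i) (f (b (u i))).
Proof.
move=> f_homo s_inj t_inj bsa atb.
have [p ap] := sorting_perm a; have [q bq] := sorting_perm b.
exists (p^-1 * q)%g => i; rewrite permM; set k := (p^-1)%g i.
have -> : i = p k by rewrite permKV.
split; first exact: sorted_dominated f_homo s_inj ap bq bsa k.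
exact: sorted_dominated f_homo t_inj bq ap atb k.
Qed.

End SortedMatching.

(** The order is lexicographic with the fixed endpoint [q] first, and the shift acts on the second
    coordinate only. Domination in both directions rules out a strict inequality in the first
    coordinate, so the bounds on [p] remain. *)
Lemma one_sided_lex_matchings (R : realType) n (p q p' q' : 'I_n -> \bar R)
    (s t : 'I_n -> 'I_n) (d : R) :
  injective s -> injective t ->
  (forall i, (p' (s i) <= p i + d%:E)%E) -> (forall i, (q' (s i) <= q i)%E) ->
  (forall i, (p (t i) <= p' i + d%:E)%E) -> (forall i, (q (t i) <= q' i)%E) ->
  exists u : {perm 'I_n}, forall i,
    [/\ q' (u i) = q i, (p' (u i) <= p i + d%:E)%E &
        (p i <= p' (u i) + d%:E)%E].
Proof.
move=> s_inj t_inj ps qs pt qt.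
pose leT (x y : \bar R * \bar R) :=
  ((x.1 < y.1) || ((x.1 == y.1) && (x.2 <= y.2)))%E.
have tot : total leT.
  by move=> x y; rewrite /leT; case: (ltgtP x.1 y.1) => //= _; exact: le_total.
have tr : transitive leT.
  move=> y x z; rewrite /leT.
  move=> /orP[xy|/andP[/eqP -> xy]] /orP[yz|/andP[/eqP <- yz]].
  - by rewrite (lt_trans xy yz).
  - by rewrite xy.
  - by rewrite yz.
  - by rewrite eqxx (le_trans xy yz) orbT.
pose f (x : \bar R * \bar R) := (x.1, x.2 + d%:E)%E.
have f_homo : {homo f : x y / leT x y}.
  move=> x y; rewrite /leT /= => /orP[->//|/andP[-> xy]].
  by rewrite leeD2r ?orbT.
have leTI x y z w : (x <= y)%E -> (z <= w)%E -> leT (x, z) (y, w).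
  by rewrite /leT le_eqVlt /= => /predU1P[->|->] // ->; rewrite eqxx orbT.
have [u u_le] := one_sided_matchings tot tr (a := fun i => (q i, p i))
  (b := fun i => (q' i, p' i)) f_homo s_inj t_inj
  (fun i => leTI _ _ _ _ (qs i) (ps i)) (fun i => leTI _ _ _ _ (qt i) (pt i)).
exists u => i; have [] := u_le i; rewrite /leT /=.
by case: ltgtP => //= -> pp pp'.
Qed.

(** * Stability of singular value decompositions *)

Section BasisCoord.
Context (F : fieldType) (R : realType) (V : vectType F) (l : V -> \bar R).

Lemma basis_coordE s (v : V) : basis_of fullv s ->
  v = \sum_(i < size s) coord (in_tuple s) i v *: s`_i.
Proof. by move=> bs; apply: (coord_basis (X := in_tuple s)) bs (memvf v). Qed.

Lemma orthogonal_coord_le n (s : n.-tuple V) v i : filtration_function l ->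
  orthogonal_basis l s -> coord s i v != 0 -> (l s`_i <= l v)%E.
Proof.
move=> lP [bs /(filt_orthogonalP lP) os].
(* The length [n] is replaced by [size s], which makes the tuple equal to [in_tuple s]. *)
case: s => s sn in i bs os *; have ns := eqP sn; case: n / ns in sn i bs os *.
have -> : Tuple sn = in_tuple s by exact: val_inj.
move=> ci; rewrite [in leRHS](basis_coordE v bs).
exact: (os (fun i => coord (in_tuple s) i v)).
Qed.

End BasisCoord.

Section SVDMatching.
Context (F : fieldType) (R : realType).

Definition svd_death (V : vectType F) (lV : V -> \bar R) (r : nat) (ys : seq V)
    (i : nat) : \bar R :=
  if (i < r)%N then lV ys`_i else +oo%E.

Lemma svd_ker_eq0 (V W : vectType F) (lV : V -> \bar R) (lW : W -> \bar R)
    (A : 'Hom(V, W)) ys xs i :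
  is_svd lV lW A ys xs -> (\dim (limg A) <= i < size ys)%N -> A ys`_i = 0.
Proof.
move=> svd /andP[ri iy]; apply/eqP; rewrite -memv_ker.
apply: (basis_mem (svd_ker svd)).
rewrite -(subnKC ri) -nth_drop mem_nth // size_drop ltn_sub2r //.
exact: leq_ltn_trans iy.
Qed.

Lemma svd_rank_le (V W : vectType F) (lV : V -> \bar R) (lW : W -> \bar R)
    (A : 'Hom(V, W)) ys xs :
  is_svd lV lW A ys xs ->
  (\dim (limg A) <= size ys)%N /\ (\dim (limg A) <= size xs)%N.
Proof.
case=> [[bys _] [bxs _] _ _ _].
rewrite -(size_basis (X := in_tuple xs) bxs).
rewrite -(size_basis (X := in_tuple ys) bys).
split; last exact/dimvS/subvf.
by rewrite -(limg_ker_dim A fullv) leq_addl.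
Qed.

(** For [j] below the rank the coordinate of [A v] at [j] is that of [v] at [j], and at larger [j]
    it vanishes. So a nonzero one means that the basis vector of index [j] occurs in [v], and
    orthogonality bounds its level. *)
Lemma svd_death_le (V W : vectType F) (lV : V -> \bar R) (lW : W -> \bar R)
    (A : 'Hom(V, W)) n ys (xs : n.-tuple W) v (j : 'I_n) :
  filtration_function lV -> is_svd lV lW A ys xs -> coord xs j (A v) != 0 ->
  (svd_death lV (\dim (limg A)) ys j <= lV v)%E.
Proof.
move=> lVP svd; have [oys [bxs _] _ _ Ays] := svd.
have [_ rx] := svd_rank_le svd; rewrite size_tuple in rx.
have [//|ninv] := boolP (svd_death lV (\dim (limg A)) ys j <= lV v)%E.
rewrite {1}(basis_coordE v (proj1 oys)) linear_sum linear_sum /=.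
rewrite big1 ?eqxx // => i _; rewrite !linearZ /=.
have [ri|ir] := leqP (\dim (limg A)) i.
  by rewrite (svd_ker_eq0 svd) ?ri //= linear0 mulr0.
have ix := leq_trans ir rx; rewrite Ays //.
rewrite (_ : xs`_i = xs`_(Ordinal ix)) // coord_free ?(basis_free bxs) //.
have [/(congr1 val)/= ij|] := eqVneq; last by rewrite mulr0.
apply/eqP; rewrite mulr1; apply: contraNT ninv => ci.
by rewrite /svd_death -ij ir; exact: (orthogonal_coord_le (s := in_tuple ys)).
Qed.

(** A nonzero entry at [(i, s i)] bounds the birth directly. For the death, [xs] at [i] is the
    boundary of [ys] at [i], so the same entry is a coordinate of [A'] applied to the image of that
    vector under [fV]. *)
Lemma svd_one_sided_matching (V V' W W' : vectType F) (lV : V -> \bar R)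
    (lV' : V' -> \bar R) (lW : W -> \bar R) (lW' : W' -> \bar R)
    (A : 'Hom(V, W)) (A' : 'Hom(V', W')) n ys (xs : n.-tuple W)
    ys' (xs' : n.-tuple W') (fV : V -> V') (fW : 'Hom(W, W'))
    (gW : 'Hom(W', W)) (a b : R) :
  filtration_function lV -> filtration_function lV' ->
  filtration_function lW' ->
  is_svd lV lW A ys xs -> is_svd lV' lW' A' ys' xs' ->
  cancel fW gW -> (forall v, fW (A v) = A' (fV v)) ->
  (forall v, (lV' (fV v) <= lV v + b%:E)%E) ->
  (forall w, (lW' (fW w) <= lW w + a%:E)%E) ->
  exists s : {perm 'I_n}, forall i,
    (lW' xs'`_(s i) <= lW xs`_i + a%:E)%E /\
    (svd_death lV' (\dim (limg A')) ys' (s i) <=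
       svd_death lV (\dim (limg A)) ys i + b%:E)%E.
Proof.
move=> lVP lV'P lW'P svd svd' fWK fA lfV lfW.
have [_ [bxs _] _ _ Ays] := svd; have [_ [bxs' oxs'] _ _ _] := svd'.
pose M := \matrix_(i < n, j < n) coord xs' j (fW xs`_i).
pose N := \matrix_(j < n, k < n) coord xs k (gW xs'`_j).
have MN : M *m N = 1%:M.
  apply/matrixP => i k; rewrite !mxE -(coord_free i k (basis_free bxs)).
  rewrite -[xs`_i in RHS]fWK (coord_basis bxs' (memvf (fW _))) !linear_sum /=.
  by apply: eq_bigr => j _; rewrite !mxE !linearZ.
(* If every permutation met a zero entry, all terms of the Leibniz expansion would vanish, and with
   them the determinant. *)
have [s Ms] : exists s : {perm 'I_n}, forall i, M i (s i) != 0.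
  apply: contrapT => nex; have : \det M != 0.
    by rewrite -unitfE -unitmxE; case: (mulmx1_unit MN).
  rewrite /determinant big1 ?eqxx // => s _.
  have [i /negP/negPn/eqP Mi] : exists i, ~ M i (s i) != 0.
    apply: contrapT => nei; apply: nex; exists s => i.
    by apply: contrapT => ni; apply: nei; exists i.
  by rewrite (bigD1 i) //= Mi mul0r mulr0.
exists s => i; have := Ms i; rewrite mxE => ci; split.
  apply: le_trans (lfW _).
  exact: (orthogonal_coord_le (s := xs') lW'P).
rewrite {2}/svd_death; case: ltnP => ir; last by rewrite addye ?leey.
apply: le_trans (lfV _); apply: (svd_death_le (xs := xs') lV'P svd').
by rewrite -fA Ays.
Qed.

End SVDMatching.

Lemma svd_stability (F : fieldType) (R : realType) (V V' W W' : vectType F)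
    (lV : V -> \bar R) (lV' : V' -> \bar R) (lW : W -> \bar R)
    (lW' : W' -> \bar R) (A : 'Hom(V, W)) (A' : 'Hom(V', W')) n
    ys (xs : n.-tuple W) ys' (xs' : n.-tuple W')
    (fV : 'Hom(V, V')) (gV : 'Hom(V', V)) (fW : 'Hom(W, W'))
    (gW : 'Hom(W', W)) (d : R) :
  filtration_function lV -> filtration_function lV' ->
  filtration_function lW -> filtration_function lW' ->
  is_svd lV lW A ys xs -> is_svd lV' lW' A' ys' xs' ->
  cancel gV fV -> cancel fW gW -> cancel gW fW ->
  (forall v, fW (A v) = A' (fV v)) ->
  (forall v, (lV' (fV v) <= lV v + d%:E)%E) ->
  (forall v, (lV (gV v) <= lV' v + d%:E)%E) ->
  (forall w, (lW' (fW w) <= lW w + d%:E)%E) ->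
  (forall w, (lW (gW w) <= lW' w + d%:E)%E) ->
  exists u : {perm 'I_n}, forall i,
    [/\ (lW' xs'`_(u i) <= lW xs`_i + d%:E)%E,
        (lW xs`_i <= lW' xs'`_(u i) + d%:E)%E,
        (svd_death lV' (\dim (limg A')) ys' (u i) <=
           svd_death lV (\dim (limg A)) ys i + d%:E)%E &
        (svd_death lV (\dim (limg A)) ys i <=
           svd_death lV' (\dim (limg A')) ys' (u i) + d%:E)%E].
Proof.
move=> lVP lV'P lWP lW'P svd svd' gVK fWK gWK fA lfV lgV lfW lgW.
(* [B] mixes the two filtrations: births and deaths move separately. *)
pose B := (A' \o fV)%VF.
have [yt [xt0 svdB0]] : exists ys xs, is_svd lV lW' B ys xs.
  apply: exists_svd => //; first by exists ys; exact: svd_domain svd.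
  by exists xs'; exact: svd_codomain svd'.
have xtn : size xt0 == n.
  have [[b0 _] [b' _]] := (svd_codomain svdB0, svd_codomain svd').
  by rewrite -(size_basis b') (size_basis (X := in_tuple xt0) b0).
pose xt := Tuple xtn.
have svdB : is_svd lV lW' B yt xt by [].
have le0 (U : vectType F) (l : U -> \bar R) w : (l w <= l w + 0%:E)%E.
  by rewrite adde0.
have e0 (x y : \bar R) : (x <= y + 0%:E -> x <= y)%E by rewrite adde0.
(* From [A] to [B] the filtration on the domain is the same: deaths are fixed and births move by at
   most [d]. *)
have [s sP] := svd_one_sided_matching (fV := id) lVP lVP lW'P svd svdB fWK
  (fun v => etrans (fA v) (esym (comp_lfunE _ _ _))) (le0 _ lV) lfW.
have gB v : gW (B v) = A v by rewrite comp_lfunE -fA fWK.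
have [t tP] := svd_one_sided_matching (fV := id) lVP lVP lWP svdB svd gWK gB
  (le0 _ lV) lgW.
have [u1 u1P] := one_sided_lex_matchings (@perm_inj _ s) (@perm_inj _ t)
  (fun i => proj1 (sP i))
  (fun i => e0 _ _ (proj2 (sP i)))
  (fun i => proj1 (tP i))
  (fun i => e0 _ _ (proj2 (tP i))).
have idK : cancel (\1%VF : 'End(W')) (\1%VF : 'End(W')).
  by move=> w; rewrite !id_lfunE.
have le1 w : (lW' ((\1%VF : 'End(W')) w) <= lW' w + 0%:E)%E.
  by rewrite id_lfunE adde0.
(* From [B] to [A'] the codomain and its filtration are the same: births are fixed and deaths move
   by at most [d]. *)
have [s' s'P] := svd_one_sided_matching (fV := fV) lVP lV'P lW'P svdB svd' idK
  (fun v => etrans (id_lfunE _) (comp_lfunE _ _ _)) lfV le1.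
have B1 v : (\1%VF : 'End(W')) (A' v) = B (gV v).
  by rewrite id_lfunE comp_lfunE gVK.
have [t' t'P] := svd_one_sided_matching (fV := gV) lV'P lVP lW'P svd' svdB idK
  B1 lgV le1.
have [u2 u2P] := one_sided_lex_matchings (@perm_inj _ s') (@perm_inj _ t')
  (fun i => proj2 (s'P i))
  (fun i => e0 _ _ (proj1 (s'P i)))
  (fun i => proj2 (t'P i))
  (fun i => e0 _ _ (proj1 (t'P i))).
exists (u1 * u2)%g => i; rewrite permM.
have [e1 p1 p2] := u1P i; have [e2 q1 q2] := u2P (u1 i).
by rewrite e2 -e1.
Qed.

(** * Filtrations on subspaces, cycles and verbose barcodes *)

Section Subspace.
Context (F : fieldType) (R : realType) (V : vectType F) (l : V -> \bar R).
Context (lP : filtration_function l).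

Lemma filtration_function_subvs (U : {vspace V}) :
  filtration_function (fun x : subvs_of U => l (vsval x)).
Proof.
have [h1 h2 h3 h4] := lP; split=> //.
- move=> x; split=> [/h2 x0|->]; last by apply/h2.
  exact: val_inj.
- by move=> a x a0; rewrite linearZ h3.
by move=> x y; rewrite linearD h4.
Qed.

Lemma filt_orthogonal_comp (W : vectType F) (g : 'Hom(W, V)) s :
  filtration_function (l \o g) ->
  filt_orthogonal l (map g s) -> filt_orthogonal (l \o g) s.
Proof.
move=> lgP; elim: s => [_|x s IH].
  by apply/filt_orthogonalP => // a [].
move=> /(filt_orthogonal_cons lP)[/IH os xs].
apply/filt_orthogonal_cons => //; split=> // u us /=.
by rewrite linearD xs // -limg_span memv_img.
Qed.

Lemma orthogonal_basis_subvs (U : {vspace V}) s :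
  basis_of U s -> filt_orthogonal l s ->
  orthogonal_basis (fun x : subvs_of U => l (vsval x)) (map (vsproj U) s).
Proof.
move=> bs os; split.
  rewrite basisEdim size_map; apply/andP; split; last first.
    by rewrite dimvf /dim /= (size_basis (X := in_tuple s) bs).
  apply/subvP => x _.
  rewrite -(vsvalK x) -(lfunE (vsproj U)).
  rewrite (eq_map (g := linfun (vsproj U))) => [|z]; last by rewrite lfunE.
  by rewrite -limg_span memv_img // (span_basis bs) subvsP.
have E : (fun x : subvs_of U => l (vsval x)) = l \o linfun (vsval (U := U)).
  by apply/funext => x; rewrite /= lfunE.
have sE : map (linfun (vsval (U := U))) (map (vsproj U) s) = s.
  rewrite -map_comp -[RHS]map_id; apply/eq_in_map => z zs /=.
  by rewrite lfunE /= vsprojK // (basis_mem bs).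
have := filtration_function_subvs U; rewrite E => lsP.
by apply: filt_orthogonal_comp => //; rewrite sE.
Qed.

Lemma filt_orthogonal_catr s1 s2 :
  filt_orthogonal l (s1 ++ s2) -> filt_orthogonal l s2.
Proof. by elim: s1 => //= x s1 IH /(filt_orthogonal_behead lP). Qed.

(** The part of the domain basis beyond the rank, in a singular value decomposition of [A], is an
    orthogonal basis of the kernel. *)
Lemma orthogonalizable_lker (W : vectType F) (lW : W -> \bar R)
    (A : 'Hom(V, W)) :
  filtration_function lW -> orthogonalizable l -> orthogonalizable lW ->
  orthogonalizable (fun x : subvs_of (lker A) => l (vsval x)).
Proof.
move=> lWP oV oW.
have [ys [xs [[bys oys] _ kerA _ _]]] := exists_svd A lP lWP oV oW.
exists (map (vsproj (lker A)) (drop (\dim (limg A)) ys)).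
apply: orthogonal_basis_subvs => //.
apply: (@filt_orthogonal_catr (take (\dim (limg A)) ys)).
by rewrite cat_take_drop.
Qed.

End Subspace.

Section Cycles.
Context (F : fieldType) (R : realType).
Implicit Types C D : FCC F R.

Lemma filt_cyclesP C k : filtration_function (@filt_cycles F R C k).
Proof. exact: (filtration_function_subvs (filtP C k)). Qed.

Lemma filt_cycles_orth C k : orthogonalizable (@filt_cycles F R C k).
Proof.
case: k => [|k]; last first.
  exact: (orthogonalizable_lker (filtP C k.+1) (bd C k) (filtP C k)
    (filt_orth C k.+1) (filt_orth C k)).
have [s [bs os]] := filt_orth C 0.
exists (map (vsproj (cycles C 0)) s).
exact: (orthogonal_basis_subvs (filtP C 0)).
Qed.

Lemma bd_in_cycles C k x : bd C k x \in cycles C k.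
Proof. by case: k x => [|k] x; rewrite ?memvf // memv_ker bd_bd. Qed.

Lemma vsval_bd_cycles C k x : vsval (bd_cycles C k x) = bd C k x.
Proof. by rewrite comp_lfunE lfunE /= vsprojK // bd_in_cycles. Qed.

Lemma verbose_barcodeP C k : is_verbose_barcode C k (verbose_barcode C k).
Proof.
have [ys [xs svd]] := exists_svd (bd_cycles C k) (filtP C k.+1)
  (@filt_cyclesP C k) (filt_orth C k.+1) (@filt_cycles_orth C k).
by apply: (@xgetPex _ [::]); eexists; exists ys, xs; split; first exact: svd.
Qed.

(** In extended reals the four one-sided inequalities also force the right endpoints to be both
    finite or both infinite, so no separate case is needed when bars are matched. *)
Lemma bar_dist_le (p p' q q' : \bar R) (d : R) :
  p \is a fin_num -> p' \is a fin_num -> q != -oo%E -> q' != -oo%E ->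
  (bar_dist (fine p, q) (fine p', q') <= d%:E)%E =
  [&& p <= p' + d%:E, p' <= p + d%:E, q <= q' + d%:E & q' <= q + d%:E]%E.
Proof.
case: p p' => [p||] [p'||] // _ _; case: q q' => [q||] [q'||] // _ _;
  rewrite /bar_dist /= -?EFinD ?lee_fin ?leye_eq ?andbF //.
  rewrite ge_max !ler_distl; lra.
by rewrite andbT ler_distl; lra.
Qed.

End Cycles.

(** * Interleavings as filtered chain isomorphisms *)

Lemma exists_linfun (F : fieldType) (U V : vectType F) (f : U -> V) :
  linear f -> exists h : 'Hom(U, V), h =1 f.
Proof.
move=> lf.
pose fl : {linear U -> V} := HB.pack f (GRing.isLinear.Build _ _ _ _ f lf).
by exists (linfun fl) => x; rewrite lfunE.
Qed.

Section Interleaving.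
Context (F : fieldType) (R : realType).
Implicit Types C D : FCC F R.

Definition filtered_map C D (d : R)
    (f : forall k, 'Hom(chain C k, chain D k)) : Prop :=
  (forall k x, f k (bd C k x) = bd D k (f k.+1 x)) /\
  (forall k x, (filt (f k x) <= filt x + d%:E)%E).

(** From such a level on, the sublevel set in degree [k] is the whole chain space, so an
    interleaving yields maps of the full spaces. *)
Lemma filt_bounded C k : exists T : R, forall x : chain C k, (filt x <= T%:E)%E.
Proof.
have [s [bs _]] := filt_orth C k; have lP := filtP C k.
exists (\big[Num.max/0]_(i < size s) fine (filt s`_i)) => x.
rewrite (basis_coordE x bs); apply: filt_fun_sum => // i _.
apply: le_trans (filt_funZ_le lP _ _) _.
apply: le_trans (_ : (_ <= (fine (filt s`_i))%:E)%E) _.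
  by case: (filt _) (filt_fun_lty lP s`_i) => //= _; rewrite leNye.
by rewrite lee_fin; exact: le_bigmax.
Qed.

Lemma shift_map_filtered C D (d : R) (f : shift_map C D d) :
  exists2 h : forall k, 'Hom(chain C k, chain D k), filtered_map d h &
    forall t k (x : sub_chain C t k),
      sub_chain_val (f t k x) = h k (sub_chain_val x).
Proof.
have [T leT] := boolp.choice (filt_bounded C).
pose f0 k (x : chain C k) := sub_chain_val (f (T k) k (SubChain (leT k x))).
have fE t k (x : sub_chain C t k) :
    sub_chain_val (f t k x) = f0 k (sub_chain_val x).
  (* Compatibility with inclusions compares the levels [t] and [T k] inside a common larger one. *)
  pose t' := Num.max t (T k).
  have tt' : t <= t' by rewrite le_max lexx.
  have Tt' : T k <= t' by rewrite le_max lexx orbT.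
  have -> : sub_chain_val (f t k x) = sub_chain_val (f t' k (sub_incl tt' x)).
    by rewrite smap_incl.
  rewrite /f0.
  set y := SubChain _; have -> : sub_incl tt' x = sub_incl Tt' y.
    exact: val_inj.
  by rewrite smap_incl.
have f0lin k : linear (f0 k).
  move=> a x y.
  rewrite -[RHS]/(val (a *: f (T k) k (SubChain (leT k x)) +
    f (T k) k (SubChain (leT k y)))).
  by rewrite -linearP; congr (val (f (T k) k _)); exact: val_inj.
have hE k := cid (exists_linfun (f0lin k)).
pose h k := sval (hE k); have hf k x : h k x = f0 k x := svalP (hE k) x.
exists h; last by move=> t k x; rewrite fE hf.
split=> [k x|k x]; rewrite !hf.
  pose y := SubChain (leT k.+1 x).
  have -> : bd C k x = sub_chain_val (sub_bd y) by [].
  by rewrite -fE smap_bd.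
(* The sharp bound comes from the map at the level of [x] itself, which is a real number only when
   [x] is nonzero. *)
have [->|x0] := eqVneq x 0.
  rewrite -hf linear0 (_ : filt 0 = -oo)%E ?leNye //.
  exact: filt_fun0 (filtP D k).
have lx : (filt x <= (fine (filt x))%:E)%E.
  by rewrite fineK // (filt_fun_fin (filtP C k)).
have := sub_chainP (f _ k (SubChain (lx : x \in sublevel (fine (filt x))))).
rewrite fE /= unfold_in /sublevel => /le_trans; apply.
by rewrite EFinD fineK // (filt_fun_fin (filtP C k)).
Qed.

Lemma filtered_shift_map C D (d : R)
    (h : forall k, 'Hom(chain C k, chain D k)) : filtered_map d h ->
  exists f : shift_map C D d, forall t k (x : sub_chain C t k),
      sub_chain_val (f t k x) = h k (sub_chain_val x).
Proof.
move=> [hbd hd].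
have hP t k (x : sub_chain C t k) :
    h k (sub_chain_val x) \in @sublevel _ _ D k (t + d).
  rewrite unfold_in /sublevel; apply: le_trans (hd _ _) _.
  by rewrite EFinD leeD2r //; exact: sub_chainP.
pose f0 t k (x : sub_chain C t k) := SubChain (hP t k x).
have f0lin t k : linear (@f0 t k).
  by move=> a x y; apply: val_inj; rewrite /= linearP.
pose fl t k : {linear sub_chain C t k -> sub_chain D (t + d) k} :=
  HB.pack (@f0 t k) (GRing.isLinear.Build _ _ _ _ (@f0 t k) (@f0lin t k)).
have flbd t k (x : sub_chain C t k.+1) :
    fl t k (sub_bd x) = sub_bd (fl t k.+1 x).
  by apply: val_inj => /=; rewrite hbd.
have fli t t' k (tt' : t <= t') (x : sub_chain C t k) :
    fl t' k (sub_incl tt' x) = sub_incl (lerD tt' (lexx d)) (fl t k x).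
  exact: val_inj.
by exists (ShiftMap flbd fli).
Qed.

(** At a level that bounds the whole degree, the inclusions in the interleaving identities act as
    the identity, so the two full maps are mutually inverse. *)
Lemma interleavedP C D (d : R) : interleaved C D d <->
  0 <= d /\ exists (f : forall k, 'Hom(chain C k, chain D k))
                   (g : forall k, 'Hom(chain D k, chain C k)),
    [/\ filtered_map d f, filtered_map d g,
        forall k, cancel (f k) (g k) & forall k, cancel (g k) (f k)].
Proof.
split=> [[d0 [f [g [gf fg]]]]|[d0 [f [g [fP gP fK gK]]]]].
  have [f' f'P f'E] := shift_map_filtered f.
  have [g' g'P g'E] := shift_map_filtered g.
  split=> //; exists f', g'; split=> // k x.
    have [T leT] := filt_bounded C k.
    have := gf T k (SubChain (leT x)) => /(congr1 (@sub_chain_val _ _ _ _ _)).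
    by rewrite g'E f'E.
  have [T leT] := filt_bounded D k.
  have := fg T k (SubChain (leT x)) => /(congr1 (@sub_chain_val _ _ _ _ _)).
  by rewrite f'E g'E.
have [f' f'E] := filtered_shift_map fP; have [g' g'E] := filtered_shift_map gP.
exists d0, f', g'; split=> t k x; apply: val_inj => /=.
  by rewrite g'E f'E fK.
by rewrite f'E g'E gK.
Qed.

End Interleaving.

(** * Bounds on the matching distance and explicit bijections *)

Section MatchingDist.
Context (R : realType).
Implicit Types A B : seq (R * \bar R).

Lemma matching_dist_ge0 A B : (0 <= matching_dist A B)%E.
Proof. by apply/ereal_infP => _ [phi _ <-]; exact: bigmax_ge_id. Qed.

Lemma matching_dist_le A B n (u : {perm 'I_n}) (d : R) :
  0 <= d -> size A = n -> size B = n ->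
  (forall i : 'I_n, (bar_dist (nth (0%R, +oo%E) A i) (nth (0%R, +oo%E) B (u i))
     <= d%:E)%E) ->
  (matching_dist A B <= d%:E)%E.
Proof.
move=> d0 eA eB ud.
pose phi (i : 'I_(size A)) := cast_ord (esym eB) (u (cast_ord eA i)).
apply: (@le_trans _ _ (\big[maxe/0%E]_(i < size A)
  bar_dist (nth (0%R, +oo%E) A i) (nth (0%R, +oo%E) B (phi i)))).
  apply: ereal_inf_lbound; exists phi => //=.
  exists (fun j => cast_ord (esym eA) ((u^-1)%g (cast_ord eB j))) => i.
    by rewrite /phi cast_ordKV permK cast_ordK.
  by rewrite /phi cast_ordKV permKV cast_ordK.
by apply: bigmax_le => // i _; exact: (ud (cast_ord eA i)).
Qed.

(** A strict bound on the infimum produces a bijection. It is extended to natural numbers so that it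
    can index lists without casts between ordinals. *)
Lemma matching_dist_lt A B (d : R) : (matching_dist A B < d%:E)%E ->
  exists phi psi : nat -> nat,
    [/\ forall i, (i < size A)%N -> (phi i < size B)%N /\ psi (phi i) = i,
        forall j, (j < size B)%N -> (psi j < size A)%N /\ phi (psi j) = j &
        forall i, (i < size A)%N ->
          (bar_dist (nth (0%R, +oo%E) A i) (nth (0%R, +oo%E) B (phi i))
             <= d%:E)%E].
Proof.
move=> /ereal_inf_lt[_ [phi /= [psi phiK psiK] <-]] lt_d.
(* The default 0 is taken only outside the range of positions. *)
pose ext m n (h : 'I_m -> 'I_n) i := oapp (fun j => h j : nat) 0%N (insub i).
have extE m n (h : 'I_m -> 'I_n) (i : 'I_m) : ext m n h i = h i.
  by rewrite /ext valK.
exists (ext _ _ phi), (ext _ _ psi).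
split=> i il; rewrite -[i]/(val (Ordinal il)).
- by rewrite extE; split=> //; rewrite extE phiK.
- by rewrite extE; split=> //; rewrite extE psiK.
by rewrite extE; apply: le_trans (ltW lt_d); exact: le_bigmax.
Qed.

End MatchingDist.

(** * Interleaved complexes have close barcodes *)

Section BarcodeMatching.
Context (F : fieldType) (R : realType).
Implicit Types C D : FCC F R.

Lemma filtered_map_cycles C D d (f : forall k, 'Hom(chain C k, chain D k)) k :
  filtered_map d f ->
  exists h : 'Hom(subvs_of (cycles C k), subvs_of (cycles D k)),
    forall x, vsval (h x) = f k (vsval x).
Proof.
move=> [fbd _]; exists (linfun (vsproj (cycles D k)) \o f k \o
  linfun (vsval (U := cycles C k)))%VF => x.
rewrite !comp_lfunE !lfunE /= vsprojK //.
case: k x => [|k] x /=; rewrite ?memvf //.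
by have := subvsP x; rewrite !memv_ker -fbd => /eqP ->; rewrite linear0.
Qed.

Lemma svd_bars_fin (V W : vectType F) (lV : V -> \bar R) (lW : W -> \bar R)
    (A : 'Hom(V, W)) ys xs i :
  filtration_function lV -> filtration_function lW ->
  is_svd lV lW A ys xs -> (i < size xs)%N ->
  lW xs`_i \is a fin_num /\ svd_death lV (\dim (limg A)) ys i != -oo%E.
Proof.
move=> lVP lWP svd ix; split.
  apply: (filt_fun_fin lWP); apply: (basis_not0 (proj1 (svd_codomain svd))).
  exact: mem_nth.
rewrite /svd_death; case: ltnP => // ir.
have : lV ys`_i \is a fin_num.
  apply: (filt_fun_fin lVP); apply: (basis_not0 (proj1 (svd_domain svd))).
  by rewrite mem_nth // (leq_trans ir) //; case: (svd_rank_le svd).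
by case: (lV _).
Qed.

Lemma nth_bars C k (ys : seq (chain C k.+1)) (xs : seq (subvs_of (cycles C k)))
    r i :
  (i < size xs)%N ->
  nth (0%R, +oo%E) [seq (fine (filt_cycles xs`_i),
              if (i < r)%N then filt ys`_i else +oo%E)
        | i <- iota 0 (size xs)] i =
  (fine (filt_cycles xs`_i), svd_death (@filt _ _ C k.+1) r ys i).
Proof. by move=> ix; rewrite (nth_map 0%N) ?size_iota // nth_iota. Qed.

Lemma matching_dist_barcode_le C D (d : R) k : interleaved C D d ->
  (matching_dist (verbose_barcode C k) (verbose_barcode D k) <= d%:E)%E.
Proof.
move=> /interleavedP[d0 [f [g [fP gP fK gK]]]].
have [ys [xs [svd ->]]] := verbose_barcodeP C k.
have [ys' [xs' [svd' ->]]] := verbose_barcodeP D k.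
have [fW fWE] := filtered_map_cycles k fP.
have [gW gWE] := filtered_map_cycles k gP.
have fWK : cancel fW gW by move=> x; apply: subvs_inj; rewrite gWE fWE fK.
have gWK : cancel gW fW by move=> x; apply: subvs_inj; rewrite fWE gWE gK.
have [xs'_basis _] := svd_codomain svd'; have [xs_basis _] := svd_codomain svd.
(* The isomorphism restricts to the cycles, so their dimensions, the numbers of bars, agree. *)
have szxs : size xs' == size xs.
  rewrite -(size_basis (X := in_tuple xs) xs_basis).
  rewrite -(size_basis (X := in_tuple xs') xs'_basis).
  have k0 : lker fW == 0%VS by apply/lker0P/(can_inj fWK).
  rewrite -(limg_dim_eq (f := fW) (U := fullv)) ?(eqP k0) ?capv0 //.
  apply/eqP; congr (\dim _); apply/eqP; rewrite eqEsubv subvf andbT.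
  by apply/subvP => y _; rewrite -(gWK y) memv_img // memvf.
have fA v : fW (bd_cycles C k v) = bd_cycles D k (f k.+1 v).
  by apply: subvs_inj; rewrite fWE !vsval_bd_cycles (proj1 fP).
have [u uP] := svd_stability (xs := in_tuple xs) (xs' := Tuple szxs)
  (filtP C k.+1) (filtP D k.+1) (@filt_cyclesP F R C k) (@filt_cyclesP F R D k)
  svd svd' (gK k.+1) fWK gWK fA (fun v => proj2 fP _ v) (fun v => proj2 gP _ v)
  (fun w => eq_ind_r (fun z => filt z <= _)%E (proj2 fP _ (vsval w)) (fWE w))
  (fun w => eq_ind_r (fun z => filt z <= _)%E (proj2 gP _ (vsval w)) (gWE w)).
apply: (matching_dist_le (u := u)) => //; first by rewrite size_map size_iota.
  by rewrite size_map size_iota (eqP szxs).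
move=> i; have ui : (u i < size xs')%N by rewrite (eqP szxs).
have [a b c e] := uP i.
have [x1 y1] :=
  svd_bars_fin (filtP C k.+1) (@filt_cyclesP F R C k) svd (ltn_ord i).
have [x2 y2] := svd_bars_fin (filtP D k.+1) (@filt_cyclesP F R D k) svd' ui.
by rewrite !nth_bars // bar_dist_le //; apply/and4P; split.
Qed.

End BarcodeMatching.

(** * Linear maps defined by matchings of singular bases *)

Section BasisExtension.
Context (F : fieldType) (R : realType) (V V' : vectType F).

Lemma exists_linfun_basis (s : seq V) (t : nat -> V') : basis_of fullv s ->
  exists h : 'Hom(V, V'), forall i, (i < size s)%N -> h s`_i = t i.
Proof.
move=> bs; have [f fP] := linear_of_free s (mkseq t (size s)).
exists (linfun f) => i il; rewrite lfunE -(nth_map 0 0 f il).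
by rewrite fP ?size_mkseq ?(basis_free bs) // nth_mkseq.
Qed.

Lemma linfun_basis_inj (s : seq V) (f g : 'Hom(V, V')) : basis_of fullv s ->
  (forall i, (i < size s)%N -> f s`_i = g s`_i) -> f =1 g.
Proof.
move=> bs fg v; rewrite (basis_coordE v bs) !linear_sum.
by apply: eq_bigr => i _; rewrite !linearZ /= fg.
Qed.

(** By orthogonality each basis vector occurring in [v] lies no higher than [v], so a bound on the
    basis extends to all vectors. *)
Lemma linfun_filt_le (l : V -> \bar R) (l' : V' -> \bar R) (s : seq V)
    (f : 'Hom(V, V')) (d : R) :
  filtration_function l -> filtration_function l' -> orthogonal_basis l s ->
  (forall i, (i < size s)%N -> (l' (f s`_i) <= l s`_i + d%:E)%E) ->
  forall v, (l' (f v) <= l v + d%:E)%E.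
Proof.
move=> lP l'P os fs v; rewrite {1}(basis_coordE v (proj1 os)) linear_sum.
apply: filt_fun_sum => // i _; rewrite linearZ /=.
have [->|ci] := eqVneq (coord (in_tuple s) i v) 0.
  by rewrite scale0r (filt_fun0 l'P) leNye.
rewrite (filt_funZ l'P) //; apply: le_trans (fs i (ltn_ord i)) _.
by rewrite leeD2r //; exact: (orthogonal_coord_le (s := in_tuple s)).
Qed.

End BasisExtension.

Section SVDMaps.
Context (F : fieldType) (R : realType) (V W V' W' : vectType F)
  (lV : V -> \bar R) (lW : W -> \bar R)
  (lV' : V' -> \bar R) (lW' : W' -> \bar R)
  (A : 'Hom(V, W)) (A' : 'Hom(V', W')).

(** [v] kills the part of [ys] spanning the kernel of [A]: when [A] is a boundary map, these are
    cycles, to be moved by the matching one degree higher. *)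
Definition svd_transfer (phi : nat -> nat) (ys : seq V) (xs : seq W)
    (ys' : seq V') (xs' : seq W') (u : 'Hom(W, W')) (v : 'Hom(V, V')) : Prop :=
  (forall i, (i < size xs)%N -> u xs`_i = xs'`_(phi i)) /\
  (forall i, (i < size ys)%N ->
     v ys`_i = if (i < \dim (limg A))%N then ys'`_(phi i) else 0).

Context (d : R) (phi : nat -> nat) (ys : seq V) (xs : seq W)
  (ys' : seq V') (xs' : seq W') (lVP : filtration_function lV)
  (lWP : filtration_function lW) (lV'P : filtration_function lV')
  (lW'P : filtration_function lW') (svd : is_svd lV lW A ys xs)
  (svd' : is_svd lV' lW' A' ys' xs').

Lemma exists_svd_transfer : exists (u : 'Hom(W, W')) (v : 'Hom(V, V')),
  svd_transfer phi ys xs ys' xs' u v.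
Proof.
have [u uE] := exists_linfun_basis (fun i => xs'`_(phi i))
  (proj1 (svd_codomain svd)).
have [v vE] := exists_linfun_basis (fun i => if (i < \dim (limg A))%N then
  ys'`_(phi i) else 0) (proj1 (svd_domain svd)).
by exists u, v.
Qed.

Context (u : 'Hom(W, W')) (v : 'Hom(V, V'))
  (uv : svd_transfer phi ys xs ys' xs' u v).

Lemma svd_transfer_ker x : A x = 0 -> v x = 0.
Proof.
move=> /eqP; rewrite -memv_ker => Ax; apply/eqP; rewrite -memv_ker.
apply: subvP x Ax; rewrite -(span_basis (svd_ker svd)).
apply/span_subvP => _ /(nthP 0)[i + <-]; rewrite size_drop ltn_subRL nth_drop.
by move=> iy; rewrite memv_ker (proj2 uv) // ltnNge leq_addr.
Qed.

Context (bars_le : forall i, (i < size xs)%N ->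
  (lW' xs'`_(phi i) <= lW xs`_i + d%:E)%E /\
  (svd_death lV' (\dim (limg A')) ys' (phi i) <=
     svd_death lV (\dim (limg A)) ys i + d%:E)%E).

(** Finite bars go to finite bars, since [+oo] is not within [d] of a finite death. *)
Lemma svd_transfer_rank i : (i < \dim (limg A))%N -> (phi i < \dim (limg A'))%N.
Proof.
move=> ir; have [_ rx] := svd_rank_le svd.
have [_] := bars_le (leq_trans ir rx); rewrite /svd_death ir.
case: (phi i < _)%N => //; rewrite leye_eq => /eqP.
by have := filt_fun_lty lVP ys`_i; case: (lV _).
Qed.

Lemma svd_transfer_codomain_le w : (lW' (u w) <= lW w + d%:E)%E.
Proof.
apply: linfun_filt_le (svd_codomain svd) _ w => // i ix.
by rewrite (proj1 uv) //; case: (bars_le ix).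
Qed.

Lemma svd_transfer_domain_le x : (lV' (v x) <= lV x + d%:E)%E.
Proof.
apply: linfun_filt_le (svd_domain svd) _ x => // i iy.
rewrite (proj2 uv) //; case: ifPn => ir; last by rewrite (filt_fun0 lV'P) leNye.
have [_ rx] := svd_rank_le svd; have [_] := bars_le (leq_trans ir rx).
by rewrite /svd_death ir svd_transfer_rank.
Qed.

Lemma svd_transfer_comm x : A' (v x) = u (A x).
Proof.
rewrite -!comp_lfunE; apply: linfun_basis_inj (proj1 (svd_domain svd)) _ x.
move=> i iy; rewrite !comp_lfunE (proj2 uv) //; case: ltnP => ir.
  rewrite (svd_map svd') ?svd_transfer_rank // (svd_map svd) // (proj1 uv) //.
  by rewrite (leq_trans ir) //; case: (svd_rank_le svd).
by rewrite (svd_ker_eq0 svd) ?ir // !linear0.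
Qed.

End SVDMaps.

Section SVDInverse.
Context (F : fieldType) (R : realType) (V W V' W' : vectType F)
  (lV : V -> \bar R) (lW : W -> \bar R)
  (lV' : V' -> \bar R) (lW' : W' -> \bar R)
  (A : 'Hom(V, W)) (A' : 'Hom(V', W')) (d : R) (phi psi : nat -> nat)
  (ys : seq V) (xs : seq W) (ys' : seq V') (xs' : seq W')
  (lVP : filtration_function lV)
  (svd : is_svd lV lW A ys xs) (svd' : is_svd lV' lW' A' ys' xs')
  (u : 'Hom(W, W')) (v : 'Hom(V, V')) (u' : 'Hom(W', W)) (v' : 'Hom(V', V)).
Context (uv : svd_transfer A phi ys xs ys' xs' u v)
  (uv' : svd_transfer A' psi ys' xs' ys xs u' v').
Context (phiK : forall i, (i < size xs)%N ->
  (phi i < size xs')%N /\ psi (phi i) = i).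

Lemma svd_transferK : cancel u u'.
Proof.
move=> w; rewrite -[RHS]id_lfunE -comp_lfunE.
apply: linfun_basis_inj (proj1 (svd_codomain svd)) _ w => i ix.
have [pix piK] := phiK ix.
by rewrite comp_lfunE id_lfunE (proj1 uv) // (proj1 uv') // piK.
Qed.

(** The composite fixes the vectors of [ys] below the rank and kills the others. Such a projection
    along an orthogonal basis cannot raise levels. *)
Lemma svd_transfer_proj_le :
  (forall i, (i < \dim (limg A))%N -> (phi i < \dim (limg A'))%N) ->
  forall x, (lV (v' (v x)) <= lV x)%E.
Proof.
move=> phi_rank x; rewrite -comp_lfunE -[leRHS]adde0.
apply: linfun_filt_le (svd_domain svd) _ x => // i iy.
rewrite adde0 comp_lfunE (proj2 uv) //; case: ifPn => ir; last first.
  by rewrite linear0 (filt_fun0 lVP) leNye.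
have [[_ rx] [ry' _]] := (svd_rank_le svd, svd_rank_le svd').
have [_ piK] := phiK (leq_trans ir rx).
by rewrite (proj2 uv') (phi_rank, leq_trans (phi_rank _ ir) ry') // piK.
Qed.

End SVDInverse.

(** * Gluing the maps of consecutive degrees *)

Section Gluing.
Context (F : fieldType) (R : realType).
Implicit Types C D : FCC F R.

Definition bar_map C D (d : R) k
    (u : 'Hom(subvs_of (cycles C k), subvs_of (cycles D k)))
    (v : 'Hom(chain C k.+1, chain D k.+1)) : Prop :=
  [/\ forall x, (filt_cycles (u x) <= filt_cycles x + d%:E)%E,
      forall x, (filt (v x) <= filt x + d%:E)%E,
      forall x, bd_cycles D k (v x) = u (bd_cycles C k x) &
      forall x, bd_cycles C k x = 0 -> v x = 0].

(** Puts the map on the complement of the cycles in its own degree; in degree 0 all chains are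
    cycles, whence the value 0. *)
Definition pred_map C D (v : forall k, 'Hom(chain C k.+1, chain D k.+1)) k :
    'Hom(chain C k, chain D k) :=
  match k with 0 => 0 | k'.+1 => v k' end.

(* [pred_map w k \o pred_map v k] projects onto the complement of the cycles. *)
Definition glue C D
    (u : forall k, 'Hom(subvs_of (cycles C k), subvs_of (cycles D k)))
    (v : forall k, 'Hom(chain C k.+1, chain D k.+1))
    (w : forall k, 'Hom(chain D k.+1, chain C k.+1)) k :
    'Hom(chain C k, chain D k) :=
  (pred_map v k + (linfun (vsval (U := cycles D k)) \o u k \o
     linfun (vsproj (cycles C k)) \o (\1 - (pred_map w k \o pred_map v k))))%VF.

Lemma glueE C D u v w k (x : chain C k) : @glue C D u v w k x =
  pred_map v k x +
  vsval (u k (vsproj (cycles C k) (x - pred_map w k (pred_map v k x)))).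
Proof.
by rewrite /glue !(add_lfunE, opp_lfunE, comp_lfunE, id_lfunE, lfunE).
Qed.

Lemma pred_map_cycles C D d u v k x :
  (forall k, @bar_map C D d k (u k) (v k)) ->
  x \in cycles C k -> pred_map v k x = 0.
Proof.
move=> uv; case: k x => [|k] x /=; first by rewrite zero_lfunE.
have [_ _ _ vker] := uv k.
rewrite memv_ker => /eqP bx; apply: vker; apply: subvs_inj.
by rewrite vsval_bd_cycles bx.
Qed.

Section GluePair.
Context (C D : FCC F R) (d : R)
  (u : forall k, 'Hom(subvs_of (cycles C k), subvs_of (cycles D k)))
  (v : forall k, 'Hom(chain C k.+1, chain D k.+1))
  (u' : forall k, 'Hom(subvs_of (cycles D k), subvs_of (cycles C k)))
  (v' : forall k, 'Hom(chain D k.+1, chain C k.+1))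
  (uv : forall k, bar_map d (u k) (v k))
  (uv' : forall k, bar_map d (u' k) (v' k))
  (uK : forall k, cancel (u k) (u' k))
  (vv'_le : forall k x, (filt (v' k (v k x)) <= filt x)%E).

(** The boundary intertwines [v' \o v] with [u' \o u], which is the identity, so [x] and its
    projection have equal boundaries. *)
Lemma glue_split k (x : chain C k) :
  x - pred_map v' k (pred_map v k x) \in cycles C k.
Proof.
case: k x => [|k] x /=; first exact: memvf.
rewrite memv_ker linearB subr_eq0 /= -!vsval_bd_cycles; apply/eqP.
have [[_ _ vbd _] [_ _ v'bd _]] := (uv k, uv' k).
by rewrite v'bd vbd uK.
Qed.

(** On cycles the glued map is [u], while the boundary of a glued image only sees [v]; both sides of
    the chain map equation equal [u] of the boundary. Levels are controlled because the projection
    raises none, so neither does its complement. *)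
Lemma glue_filtered : filtered_map d (glue u v v').
Proof.
split=> k x; have [ud _ vbd _] := uv k; rewrite glueE.
  rewrite (pred_map_cycles uv) ?bd_in_cycles // add0r linear0 subr0.
  have bz : bd D k (vsval (u k.+1 (vsproj (cycles C k.+1)
      (x - v' k (v k x))))) = 0 by apply/eqP; rewrite -memv_ker subvsP.
  rewrite glueE linearD /= bz addr0 -[bd D k (v k x)]vsval_bd_cycles vbd.
  by rewrite /bd_cycles comp_lfunE lfunE.
apply: le_trans (filt_funD (filtP D k) _ _) _.
rewrite ge_max; apply/andP; split.
  case: k x {ud vbd} => [|k] x /=; last by case: (uv k).
  by rewrite zero_lfunE (filt_fun0 (filtP D 0)) leNye.
apply: le_trans (ud _) _.
rewrite leeD2r // /filt_cycles vsprojK ?glue_split //.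
apply: le_trans (filt_funB (filtP C k) _ _) _; rewrite ge_max lexx /=.
case: k x {ud vbd} => [|k] x /=; last exact: vv'_le.
by rewrite zero_lfunE (filt_fun0 (filtP C 0)) leNye.
Qed.

(** The reverse map sends the summand [v x] to the projection of [x], since [v] kills the cycle part
    of [x] and thus [v \o v' \o v] equals [v]. On the other summand, a cycle, it acts as [u'] and
    restores the cycle part. *)
Lemma glueK k : cancel (glue u v v' k) (glue u' v' v k).
Proof.
move=> x; rewrite [glue u v v' k x]glueE glueE.
set z := vsval _; have zD : z \in cycles D k by exact: subvsP.
rewrite linearD /= (pred_map_cycles uv' zD) addr0.
have -> : pred_map v k (pred_map v' k (pred_map v k x)) = pred_map v k x.
  have := pred_map_cycles uv (glue_split x).
  by rewrite linearB /= => /eqP; rewrite subr_eq0 => /eqP.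
rewrite addrAC subrr add0r vsvalK uK vsprojK ?glue_split //.
by rewrite addrC subrK.
Qed.

End GluePair.
End Gluing.

(** * Close barcodes give interleaved complexes *)

Section BarcodeInterleaving.
Context (F : fieldType) (R : realType).
Implicit Types C D : FCC F R.

Lemma exists_bar_maps C D (d : R) k :
  (matching_dist (verbose_barcode C k) (verbose_barcode D k) < d%:E)%E ->
  exists uv : 'Hom(subvs_of (cycles C k), subvs_of (cycles D k)) *
              'Hom(chain C k.+1, chain D k.+1) *
              'Hom(subvs_of (cycles D k), subvs_of (cycles C k)) *
              'Hom(chain D k.+1, chain C k.+1),
    let: (u, v, u', v') := uv in
    [/\ bar_map d u v, bar_map d u' v',
        cancel u u' /\ cancel u' u,
        forall x, (filt (v' (v x)) <= filt x)%E &
        forall x, (filt (v (v' x)) <= filt x)%E].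
Proof.
have [ys [xs [svd ->]]] := verbose_barcodeP C k.
have [ys' [xs' [svd' ->]]] := verbose_barcodeP D k.
move=> /matching_dist_lt[phi [psi []]]; rewrite !size_map !size_iota.
move=> phiK psiK dist_le.
have [[CP DP] [CcP DcP]] := ((filtP C k.+1, filtP D k.+1),
  (@filt_cyclesP F R C k, @filt_cyclesP F R D k)).
have {dist_le} dist_le i : (i < size xs)%N ->
    [&& filt_cycles xs`_i <= filt_cycles xs'`_(phi i) + d%:E,
        filt_cycles xs'`_(phi i) <= filt_cycles xs`_i + d%:E,
        svd_death (@filt _ _ C k.+1) (\dim (limg (bd_cycles C k))) ys i <=
        svd_death (@filt _ _ D k.+1) (\dim (limg (bd_cycles D k))) ys' (phi i)
          + d%:E &
        svd_death (@filt _ _ D k.+1) (\dim (limg (bd_cycles D k))) ys' (phi i)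
        <= svd_death (@filt _ _ C k.+1) (\dim (limg (bd_cycles C k))) ys i
          + d%:E]%E.
  move=> ix; have [pix _] := phiK i ix; have := dist_le i ix.
  have [a1 a2] := svd_bars_fin CP CcP svd ix.
  have [b1 b2] := svd_bars_fin DP DcP svd' pix.
  by rewrite !nth_bars // bar_dist_le.
have phi_le i : (i < size xs)%N -> _ := fun ix =>
  let: And4 _ h1 _ h2 := and4P (dist_le i ix) in conj h1 h2.
(* The bound at [i] is the one already known at [psi i], since [phi (psi i)] is [i]. *)
have psi_le i : (i < size xs')%N ->
    (filt_cycles xs`_(psi i) <= filt_cycles xs'`_i + d%:E)%E /\
    (svd_death (@filt _ _ C k.+1) (\dim (limg (bd_cycles C k))) ys (psi i) <=
     svd_death (@filt _ _ D k.+1) (\dim (limg (bd_cycles D k))) ys' i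
       + d%:E)%E.
  move=> ix; have [pix piK] := psiK i ix.
  by have := dist_le _ pix; rewrite piK => /and4P[].
have [u [v uv]] := exists_svd_transfer phi ys' xs' svd.
have [u' [v' uv']] := exists_svd_transfer psi ys xs svd'.
have phi_rank := svd_transfer_rank CP svd phi_le.
have psi_rank := svd_transfer_rank DP svd' psi_le.
exists (u, v, u', v'); split.
- split.
  + exact: (svd_transfer_codomain_le CcP DcP svd uv phi_le).
  + exact: (svd_transfer_domain_le CP DP svd uv phi_le).
  + exact: (svd_transfer_comm CP svd svd' uv phi_le).
  + exact: (svd_transfer_ker svd uv).
- split.
  + exact: (svd_transfer_codomain_le DcP CcP svd' uv' psi_le).
  + exact: (svd_transfer_domain_le DP CP svd' uv' psi_le).
  + exact: (svd_transfer_comm DP svd' svd uv' psi_le).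
  + exact: (svd_transfer_ker svd' uv').
- split; first exact: (svd_transferK svd uv uv' phiK).
  exact: (svd_transferK svd' uv' uv psiK).
- exact: (svd_transfer_proj_le CP svd svd' uv uv' phiK phi_rank).
- exact: (svd_transfer_proj_le DP svd' svd uv' uv psiK psi_rank).
Qed.

Lemma matching_dist_lt_interleaved C D (d : R) :
  (forall k,
     (matching_dist (verbose_barcode C k) (verbose_barcode D k) < d%:E)%E) ->
  interleaved C D d.
Proof.
move=> lt_d; pose h k := projT1 (cid (exists_bar_maps (lt_d k))).
pose u k := (h k).1.1.1; pose v k := (h k).1.1.2.
pose u' k := (h k).1.2; pose v' k := (h k).2.
have hP k := projT2 (cid (exists_bar_maps (lt_d k))).
have uvP k : bar_map d (u k) (v k).
  by have := hP k; rewrite -/(h k) /u /v; case: (h k) => [[[? ?] ?] ?] [].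
have uvP' k : bar_map d (u' k) (v' k).
  by have := hP k; rewrite -/(h k) /u' /v'; case: (h k) => [[[? ?] ?] ?] [].
have uK k : cancel (u k) (u' k).
  have := hP k; rewrite -/(h k) /u /u'.
  by case: (h k) => [[[? ?] ?] ?] [_ _ []].
have uK' k : cancel (u' k) (u k).
  have := hP k; rewrite -/(h k) /u /u'.
  by case: (h k) => [[[? ?] ?] ?] [_ _ []].
have v'v k x : (filt (v' k (v k x)) <= filt x)%E.
  by have := hP k; rewrite -/(h k) /v /v'; case: (h k) => [[[? ?] ?] ?] [].
have vv' k x : (filt (v k (v' k x)) <= filt x)%E.
  by have := hP k; rewrite -/(h k) /v /v'; case: (h k) => [[[? ?] ?] ?] [].
apply/interleavedP; split.
  (* Nonnegativity of [d] is read off from degree 0. *)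
  by rewrite -lee_fin; exact: le_trans (matching_dist_ge0 _ _) (ltW (lt_d 0)).
exists (glue u v v'), (glue u' v' v); split.
- exact: glue_filtered uvP uvP' uK v'v.
- exact: glue_filtered uvP' uvP uK' vv'.
- exact: glueK uvP uvP' uK.
- exact: glueK uvP' uvP uK'.
Qed.

End BarcodeInterleaving.

Theorem theorem2 (F : fieldType) (R : realType) (C D : FCC F R) :
  ereal_sup (range (fun k : nat =>
    matching_dist (verbose_barcode C k) (verbose_barcode D k))) =
  interleaving_dist C D.
Proof.
apply/eqP; rewrite eq_le; apply/andP; split.
  apply/ereal_supP => _ [k _ <-]; apply/ereal_infP => _ [d dCD <-].
  exact: matching_dist_barcode_le.
set S := ereal_sup _.
have leS k : (matching_dist (verbose_barcode C k) (verbose_barcode D k) <= S)%E.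
  by apply: ereal_sup_ubound; exists k.
(* The value [+oo] is trivial, and [-oo] contradicts nonnegativity in degree 0. *)
case ES: S leS => [s||] leS; last 2 first.
- exact: leey.
- by have := le_trans (matching_dist_ge0 _ _) (leS 0); rewrite leeNy_eq.
(* The slack [e] makes the bounds strict, as needed to extract bijections from the infima, uniformly
   in all degrees. *)
apply/lee_addgt0Pr => e e0; apply: ereal_inf_lbound; exists (s + e) => //=.
apply: matching_dist_lt_interleaved => k; apply: le_lt_trans (leS k) _.
by rewrite lte_fin ltrDl.
Qed.
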